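(* Let $\mathbf{k}$ be a field of arbitrary characteristic. Let $f\in 2^{[m]*}$ be a nice function such that $K_f=\mathrm{supp}(f)$ is an abstract simplicial complex on vertex set $[m]$. Then $$|\mathrm{supp}(\mathcal{M}(f))|\leq \sum_{i=0}^h\sum_{a\in 2^{[m]}} \beta_{i, a}^{\mathbf{k}(K_f)},$$ where $h$ denotes the length of the minimal free resolution of $\mathbf{k}(K_f)$ and $\beta_{i,a}^{\mathbf{k}(K_f)}$ are the Betti numbers of $\mathbf{k}(K_f)$.
   Context: Let $m$ be a positive integer, $[m]=\{1,\dots,m\}$, and $2^{[m]}$ the power set of $[m]$. $2^{[m]*}$ is the set of all functions $f:2^{[m]}\to\mathbb{Z}/2\mathbb{Z}=\{0,1\}$. The support is $\mathrm{supp}(f)=f^{-1}(1)\subseteq 2^{[m]}$. An abstract simplicial complex is a collection of subsets closed under taking subsets (including the empty set); it is on vertex set $[m]$ if the union of its members is $[m]$. $f$ is nice if $\mathrm{supp}(f)$ is an abstract simplicial complex. The $\mathbb{Z}/2\mathbb{Z}$-valued Möbius transform $\mathcal{M}:2^{[m]*}\to 2^{[m]*}$ is $\mathcal{M}(f)(a)=\sum_{b\subseteq a}f(b)$. Let $\mathbf{k}[\mathbf{v}]=\mathbf{k}[v_1,\dots,v_m]$ with its $\mathbb{N}^m$-grading. For $a\subseteq[m]$ put $\mathbf{v}^a=\prod_{i\in a}v_i$. The Stanley–Reisner face ring of a complex $K$ on $[m]$ is $\mathbf{k}(K)=\mathbf{k}[\mathbf{v}]/\langle \mathbf{v}^\tau\mid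 \tau\subseteq[m],\ \tau\notin K\rangle$. It has an $\mathbb{N}^m$-graded minimal free resolution $0\leftarrow \mathbf{k}(K)\leftarrow F_0\leftarrow F_1\leftarrow\cdots\leftarrow F_h\leftarrow 0$ over $\mathbf{k}[\mathbf{v}]$, with $F_i=\bigoplus_{\mathbf{a}\in\mathbb{N}^m}\mathbf{k}[\mathbf{v}](-\mathbf{a})^{\beta_{i,\mathbf{a}}^{\mathbf{k}(K)}}$, where $\mathbf{k}[\mathbf{v}](-\mathbf{a})$ is the free module generated in degree $\mathbf{a}$. For $a\in 2^{[m]}$, the Betti number $\beta_{i,a}^{\mathbf{k}(K)}$ means $\beta_{i,\mathbf{a}}^{\mathbf{k}(K)}$ with $\mathbf{a}\in\{0,1\}^m$ the indicator vector of $a$ (it is known that $\beta_{i,\mathbf{a}}^{\mathbf{k}(K)}=0$ for $\mathbf{a}\notin\{0,1\}^m$). *)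

(* Defs.v *)
From HB Require Import structures.
From mathcomp Require Import all_boot all_order all_algebra generic_quotient.
From mathcomp Require Import ring_quotient.
From mathcomp Require Import boolp mpoly.

Set Implicit Arguments.
Unset Strict Implicit.
Unset Printing Implicit Defensive.

Import GRing.Theory.
Local Open Scope ring_scope.
Local Open Scope quotient_scope.

Section BooleanFunctions.
Variable m : nat.
Implicit Types (f : {ffun {set 'I_m} -> 'F_2}) (K : {set {set 'I_m}}).

Definition supp f : {set {set 'I_m}} := [set a | f a == 1].

Definition Mobius f : {ffun {set 'I_m} -> 'F_2} :=
  [ffun a : {set 'I_m} => \sum_(b : {set 'I_m} | b \subset a) f b].

Definition is_complex K : Prop :=
  set0 \in K /\ (forall a b : {set 'I_m}, a \in K -> b \subset a -> b \in K).

Definition on_vertex_set K : Prop := cover K = [set: 'I_m].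

Definition nice f : Prop := is_complex (supp f).

Record scomplex := SComplex { faces :> {set {set 'I_m}}; facesP : is_complex faces }.

Definition nice_complex f (hf : nice f) : scomplex := SComplex hf.

Definition indicator (a : {set 'I_m}) : 'X_{1..m} := [multinom (i \in a : nat) | i < m].

End BooleanFunctions.

Section FaceRing.
Variables (k : fieldType) (m : nat).
Local Notation S := {mpoly k[m]}.

Definition vmon (a : {set 'I_m}) : S := \prod_(i in a) 'X_i.

(* The ideal generated by the v^tau for tau not in K. *)
Definition SR_ideal (K : scomplex m) : pred S := fun p =>
  `[< exists c : {set 'I_m} -> S, p = \sum_(t : {set 'I_m} | t \notin K) c t * vmon t >].

Lemma SR_idealP (K : scomplex m) (p : S) :
  reflect (exists c : {set 'I_m} -> S,
             p = \sum_(t : {set 'I_m} | t \notin K) c t * vmon t)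
          (p \in SR_ideal K).
Proof. exact: asboolP. Qed.

Lemma SR_ideal_closed (K : scomplex m) : idealr_closed (SR_ideal K).
Proof.
split.
- apply/SR_idealP; exists (fun=> 0).
  by rewrite big1 // => t _; rewrite mul0r.
- apply/negP => /SR_idealP[c /(congr1 (mcoeff 0%MM))].
  rewrite mcoeff1 eqxx raddf_sum big1 => [/eqP|t tK]; first by rewrite oner_eq0.
  have [t0|[i it]] := set_0Vmem t.
    by move: tK; rewrite t0 (proj1 (facesP K)).
  rewrite /vmon (bigD1 i) //= mulrCA rmorphM /= mcoeffX.
  rewrite (_ : (U_(i) == 0)%MM = false) ?mul0r //.
  by apply/negbTE; rewrite -mdeg_eq0 mdeg1.
- move=> a p q /SR_idealP[c ->] /SR_idealP[d ->]; apply/SR_idealP.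
  exists (fun t => a * c t + d t); rewrite mulr_sumr -big_split /=.
  by apply: eq_bigr => t _; rewrite mulrDl mulrA.
Qed.

HB.instance Definition _ (K : scomplex m) :=
  isIdealr.Build S (SR_ideal K) (SR_ideal_closed K).

Definition face_ring (K : scomplex m) := @Quotient.quot S (SR_ideal K : idealr S).

HB.instance Definition _ (K : scomplex m) := GRing.ComNzRing.on (face_ring K).

Definition face_proj (K : scomplex m) (p : S) : face_ring K := \pi_(face_ring K) p.

Lemma face_projD K : {morph @face_proj K : p q / p + q}.
Proof. by move=> p q; rewrite /face_proj rmorphD. Qed.
Lemma face_projM K : {morph @face_proj K : p q / p * q}.
Proof. by move=> p q; rewrite /face_proj rmorphM. Qed.
Lemma face_proj1 K : face_proj K 1 = 1.
Proof. by rewrite /face_proj rmorph1. Qed.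

Definition face_scale (K : scomplex m) (p : S) (y : face_ring K) : face_ring K :=
  face_proj K p * y.

Fact face_scaleA K p q (y : face_ring K) :
  face_scale p (face_scale q y) = face_scale (p * q) y.
Proof. by rewrite /face_scale face_projM mulrA. Qed.
Fact face_scale1 K : left_id 1 (@face_scale K).
Proof. by move=> y; rewrite /face_scale face_proj1 mul1r. Qed.
Fact face_scaleDr K : right_distributive (@face_scale K) +%R.
Proof. by move=> p y z; rewrite /face_scale mulrDr. Qed.
Fact face_scaleDl K (y : face_ring K) : {morph (@face_scale K)^~ y : p q / p + q}.
Proof. by move=> p q; rewrite /face_scale face_projD mulrDl. Qed.

HB.instance Definition _ (K : scomplex m) :=
  GRing.Zmodule_isLmodule.Build S (face_ring K)
    (@face_scaleA K) (@face_scale1 K) (@face_scaleDr K) (@face_scaleDl K).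

(* poly_deg a, face_deg a: the N^m-graded pieces of degree a, 0 included. *)
Definition poly_deg (a : 'X_{1..m}) (p : S) : Prop :=
  forall u, u \in msupp p -> u = a.

Definition face_deg (K : scomplex m) (a : 'X_{1..m}) (y : face_ring K) : Prop :=
  exists2 p : S, poly_deg a p & y = face_proj K p.

End FaceRing.

Section Resolutions.
Variables (k : fieldType) (m : nat).
Local Notation S := {mpoly k[m]}.

(* Degree a part of the direct sum of the S(-d j), whose j-th generator has
   degree d j. *)
Definition free_deg (n : nat) (d : 'I_n -> 'X_{1..m}) (a : 'X_{1..m})
    (x : 'rV[S]_n) : Prop :=
  forall j u, u \in msupp (x 0 j) -> (u + d j)%MM = a.

(* N^m-graded free resolutions, by finitely generated modules, of the
   S-module M graded by Mdeg:
     0 <- M <-aug- F_0 <-diff 0- F_1 <-diff 1- F_2 <- ...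
   with F_i the direct sum of the S(-res_shift i j), j < res_rank i. *)
Record graded_free_resolution (M : lmodType S) (Mdeg : 'X_{1..m} -> M -> Prop) :=
  GradedFreeResolution {
    res_rank : nat -> nat;
    res_shift : forall i, 'I_(res_rank i) -> 'X_{1..m};
    res_diff : forall i, {linear 'rV[S]_(res_rank i.+1) -> 'rV[S]_(res_rank i)};
    res_aug : {linear 'rV[S]_(res_rank 0) -> M};
    res_diff_deg : forall i a x, free_deg (@res_shift i.+1) a x ->
      free_deg (@res_shift i) a (res_diff i x);
    res_aug_deg : forall a x, free_deg (@res_shift 0%N) a x -> Mdeg a (res_aug x);
    res_aug_surj : forall y, exists x, res_aug x = y;
    res_exact0 : forall x, res_aug x = 0 <-> exists y, res_diff 0%N y = x;
    res_exact : forall i x, res_diff i x = 0 <-> exists y, res_diff i.+1 y = x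
  }.

Variables (M : lmodType S) (Mdeg : 'X_{1..m} -> M -> Prop).
Implicit Type F : graded_free_resolution Mdeg.

(* The image of F_{i+1} lies in <v_1, ..., v_m> F_i; <v_1, ..., v_m> is the
   ideal of the polynomials with zero constant term. *)
Definition minimal F : Prop :=
  forall i x j, (res_diff F i x 0 j)@_0%MM = 0.

Definition has_length F (h : nat) : Prop :=
  (0 < res_rank F h)%N /\ (forall i, (h < i)%N -> res_rank F i = 0%N).

(* The exponent of S(-a) in F_i; for F minimal, the Betti number of M. *)
Definition betti F (i : nat) (a : 'X_{1..m}) : nat :=
  #|[set j : 'I_(res_rank F i) | res_shift j == a]|.

End Resolutions.

(* Main.v *)
Require Import Defs.
From mathcomp Require Import all_boot all_order all_algebra generic_quotient.
From mathcomp Require Import ring_quotient.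
From mathcomp Require Import mpoly.

(* For b in 2^[m] the degree b strand of the resolution is an exact complex of
   finite-dimensional vector spaces; its i-th term has dimension
   sum_(a <= b) beta_(i,a), and it resolves the degree b component of the face
   ring, of dimension f(b).  The Euler characteristic modulo 2 gives
   f(b) = sum_(a <= b) B(a) with B(a) = sum_i beta_(i,a), so by Moebius inversion
   modulo 2, M(f)(a) = B(a) mod 2, and B(a) >= 1 whenever M(f)(a) = 1. *)

Set Implicit Arguments.
Unset Strict Implicit.
Unset Printing Implicit Defensive.

Import GRing.Theory.
Local Open Scope ring_scope.

(** * Coefficients of products with homogeneous polynomials *)

Section Monomials.
Variables (k : fieldType) (m : nat).
Local Notation S := {mpoly k[m]}.
Implicit Types (p q : S) (a b d u : 'X_{1..m}).

Lemma mcoeffMX_nle p d b : ~~ (d <= b)%MM -> (p * 'X_[d])@_b = 0.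
Proof.
move=> ndb; apply/memN_msupp_eq0; rewrite (perm_mem (msuppMX _ _)).
by apply: contra ndb => /mapP[u _ ->]; apply: lem_addr.
Qed.

Lemma poly_degE d q : poly_deg d q -> q = q@_d *: 'X_[d].
Proof.
move=> hq; apply/mpolyP => u; rewrite mcoeffZ mcoeffX.
have [->|ud] := eqVneq d u; first by rewrite mulr1.
rewrite mulr0; apply/memN_msupp_eq0/negP => /hq eud.
by rewrite eud eqxx in ud.
Qed.

Lemma poly_degZX (c : k) d : poly_deg d (c *: 'X_[d]).
Proof.
move=> u; rewrite mcoeff_msupp mcoeffZ mcoeffX.
by have [//|_] := eqVneq d u; rewrite mulr0 eqxx.
Qed.

(** [q] is a scalar times ['X_[d]]. If [d <= b], the second factor recovers that scalar; otherwise
    the first factor vanishes, so the truncation in [b - d] does no harm. *)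
Lemma mcoeffM_deg p q d b : poly_deg d q ->
  (p * q)@_b = (p * 'X_[d])@_b * ('X_[b - d] * q)@_b.
Proof.
move=> /poly_degE ->; rewrite -!scalerAr !mcoeffZ.
have [db|ndb] := boolP (d <= b)%MM.
  by rewrite -mpolyXD submK // mcoeffX eqxx mulr1 mulrC.
by rewrite mcoeffMX_nle // mulr0 mul0r.
Qed.

End Monomials.

(** * Degree b strands of free modules and of graded maps *)

Section Strands.
Variables (k : fieldType) (m : nat) (b : 'X_{1..m}).
Local Notation S := {mpoly k[m]}.

(* Coordinates of the degree b component of x; the j-th one is the coefficient
   of [x 0 j] at [b - d j], and 0 unless [d j <= b]. *)
Definition strand n (d : 'I_n -> 'X_{1..m}) (x : 'rV[S]_n) : 'rV[k]_n :=
  \row_j (x 0 j * 'X_[d j])@_b.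

(** The subtraction [b - d j] is truncated, so the result has degree b only for [c] in
    [strand_space]. *)
Definition unstrand n (d : 'I_n -> 'X_{1..m}) (c : 'rV[k]_n) : 'rV[S]_n :=
  \row_j (c 0 j *: 'X_[b - d j]).

Definition strand_idx n (d : 'I_n -> 'X_{1..m}) : {set 'I_n} :=
  [set j | (d j <= b)%MM].

(** The strand is kept as a coordinate subspace of the full row space, so that row vectors and
    matrices have sizes independent of b. *)
Definition strand_space n (d : 'I_n -> 'X_{1..m}) : 'M[k]_(#|strand_idx d|, n) :=
  rowsub enum_val 1%:M.

Lemma rank_strand_space n (d : 'I_n -> 'X_{1..m}) :
  \rank (strand_space d) = #|strand_idx d|.
Proof.
apply/eqP; apply/row_freeP; exists (colsub enum_val 1%:M).
by apply/matrixP => i j; rewrite -mxsub_mul mul1mx !mxE (inj_eq enum_val_inj).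
Qed.

Lemma strand_spaceP n (d : 'I_n -> 'X_{1..m}) (c : 'rV[k]_n) :
  reflect (forall j, ~~ (d j <= b)%MM -> c 0 j = 0) (c <= strand_space d)%MS.
Proof.
apply: (iffP idP) => [/submxP[D ->] j ndj|hc].
  rewrite !mxE big1 // => i _; rewrite !mxE.
  have := enum_valP i; rewrite inE => di.
  by case: eqP => [e|_]; rewrite ?mulr0 //; rewrite -e di in ndj.
rewrite [c]row_sum_delta; apply: summx_sub => j _.
have [dj|ndj] := boolP (d j <= b)%MM; last by rewrite hc // scale0r sub0mx.
apply: scalemx_sub.
have jd : j \in strand_idx d by rewrite inE.
rewrite (_ : 'e_j = row (enum_rank_in jd j) (strand_space d)) ?row_sub //.
by apply/rowP => i; rewrite !mxE enum_rankK_in //= eq_sym.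
Qed.

Lemma strand_sub n (d : 'I_n -> 'X_{1..m}) x : (strand d x <= strand_space d)%MS.
Proof. by apply/strand_spaceP => j ndj; rewrite mxE mcoeffMX_nle. Qed.

Lemma strandD n (d : 'I_n -> 'X_{1..m}) : {morph strand d : x y / x + y}.
Proof. by move=> x y; apply/rowP => j; rewrite !mxE mulrDl mcoeffD. Qed.

Lemma free_deg_poly n (d : 'I_n -> 'X_{1..m}) a (x : 'rV[S]_n) j :
  free_deg d a x -> poly_deg a (x 0 j * 'X_[d j]).
Proof.
by move=> hx u; rewrite (perm_mem (msuppMX _ _)) => /mapP[v /hx <- ->]; rewrite addmC.
Qed.

Lemma strandZ n (d : 'I_n -> 'X_{1..m}) p a y : free_deg d a y ->
  strand d (p *: y) = (p * 'X_[a])@_b *: strand d ('X_[b - a] *: y).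
Proof.
move=> hy; apply/rowP => j; rewrite !mxE -!mulrA.
exact: mcoeffM_deg (free_deg_poly hy).
Qed.

Lemma strand_inj n (d : 'I_n -> 'X_{1..m}) y :
  free_deg d b y -> strand d y = 0 -> y = 0.
Proof.
move=> hy /rowP y0; apply/rowP => j; move: (y0 j); rewrite !mxE => yj0.
have /poly_degE := free_deg_poly (j := j) hy; rewrite yj0 scale0r => /mpolyP yX0.
by apply/mpolyP => u; rewrite -(mcoeffMX _ (d j)) yX0 !mcoeff0.
Qed.

Lemma unstrandK n (d : 'I_n -> 'X_{1..m}) c :
  (c <= strand_space d)%MS -> strand d (unstrand d c) = c.
Proof.
move=> /strand_spaceP hc; apply/rowP => j; rewrite !mxE.
have [dj|/hc ->] := boolP (d j <= b)%MM; last by rewrite scale0r mul0r mcoeff0.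
by rewrite -scalerAl -mpolyXD submK // mcoeffZ mcoeffX eqxx mulr1.
Qed.

Lemma unstrand_deg n (d : 'I_n -> 'X_{1..m}) c :
  (c <= strand_space d)%MS -> free_deg d b (unstrand d c).
Proof.
move=> /strand_spaceP hc j u; rewrite !mxE => hu.
have [dj|/hc cj] := boolP (d j <= b)%MM.
  by rewrite (poly_degZX hu) submK.
by move: hu; rewrite cj scale0r msupp0.
Qed.

Lemma delta_deg n (d : 'I_n -> 'X_{1..m}) s :
  free_deg d (d s) (delta_mx 0 s : 'rV[S]_n).
Proof.
move=> j u; rewrite mxE eqxx /=; have [<-|_] := eqVneq j s; last by rewrite msupp0.
by rewrite msupp1 inE => /eqP ->; rewrite add0m.
Qed.

(* [psi] restricts to coordinates on the degree b component of M. *)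
Definition strand_coord (M : lmodType S) (Mdeg : 'X_{1..m} -> M -> Prop) q
    (psi : M -> 'rV[k]_q) : Prop :=
  [/\ {morph psi : x y / x + y},
      forall p a y, Mdeg a y ->
        psi (p *: y) = (p * 'X_[a])@_b *: psi ('X_[b - a] *: y)
    & forall y, Mdeg b y -> psi y = 0 -> y = 0].

Lemma strand_coord0 (M : lmodType S) (Mdeg : 'X_{1..m} -> M -> Prop) q
    (psi : M -> 'rV[k]_q) : strand_coord Mdeg psi -> psi 0 = 0.
Proof. by case=> psiD _ _; apply: (@addrI _ (psi 0)); rewrite -psiD !addr0. Qed.

Lemma strand_coord_free n (d : 'I_n -> 'X_{1..m}) :
  strand_coord (free_deg d) (strand d).
Proof.
by split; [exact: strandD | exact: strandZ | exact: strand_inj].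
Qed.

Section Maps.
Variables (M : lmodType S) (Mdeg : 'X_{1..m} -> M -> Prop) (q : nat).
Variables (psi : M -> 'rV[k]_q) (psiP : strand_coord Mdeg psi).
Variables (n : nat) (d : 'I_n -> 'X_{1..m}) (phi : {linear 'rV[S]_n -> M}).
Hypothesis phi_deg : forall a x, free_deg d a x -> Mdeg a (phi x).

(** Row [s] is the image of the basis vector ['X_[b - d s] e_s] of the strand; when [d s <= b]
    fails, the row is only ever multiplied by a zero coordinate. *)
Definition strand_mx : 'M[k]_(n, q) :=
  \matrix_s psi ('X_[b - d s] *: phi (delta_mx 0 s)).

Lemma strand_mxE x : psi (phi x) = strand d x *m strand_mx.
Proof.
have [psiD psiZ _] := psiP.
rewrite mulmx_sum_row {1}[x]row_sum_delta linear_sum (big_morph psi psiD (strand_coord0 psiP)).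
apply: eq_bigr => s _; rewrite linearZ /= (psiZ _ (d s)) ?mxE ?rowK //.
by apply: phi_deg; apply: delta_deg.
Qed.

End Maps.

(** Rank-nullity for [phi] on its degree b strand, where exactness identifies the kernel with the
    image of the strand of [phi']. *)
Lemma strand_exact (M : lmodType S) (Mdeg : 'X_{1..m} -> M -> Prop) q
    (psi : M -> 'rV[k]_q) n (d : 'I_n -> 'X_{1..m}) (phi : {linear 'rV[S]_n -> M})
    n' (d' : 'I_n' -> 'X_{1..m}) (phi' : {linear 'rV[S]_n' -> 'rV[S]_n}) :
    strand_coord Mdeg psi ->
    (forall a x, free_deg d a x -> Mdeg a (phi x)) ->
    (forall a x, free_deg d' a x -> free_deg d a (phi' x)) ->
    (forall x, phi x = 0 <-> exists y, phi' y = x) ->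
  #|strand_idx d| = (\rank (strand_space d *m strand_mx psi d phi) +
                     \rank (strand_space d' *m strand_mx (strand d) d' phi'))%N.
Proof.
move=> psiP hphi hphi' ex.
have E := strand_mxE psiP hphi; have E' := strand_mxE (strand_coord_free d) hphi'.
rewrite -[LHS](rank_strand_space d) -(mxrank_mul_ker _ (strand_mx psi d phi)).
congr addn; apply/eqmx_rank/andP; split; apply/row_subP => i.
  set c := row i _.
  have : (c <= strand_space d :&: kermx (strand_mx psi d phi))%MS by apply: row_sub.
  rewrite sub_capmx => /andP[cV /sub_kermxP cK].
  have [_ _ psi_inj] := psiP.
  (* A kernel vector lifts to a homogeneous element killed by [phi]. Its preimage [y] need not be
     homogeneous: only the strand of [y] enters. *)
  have /ex[y hy] : phi (unstrand d c) = 0.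
    by apply: psi_inj; [apply/hphi/unstrand_deg | rewrite E unstrandK].
  by rewrite -(unstrandK cV) -hy E'; apply/submxMr/strand_sub.
rewrite row_mul; have := row_sub i (strand_space d').
move: (row i _) => c cV; rewrite -(unstrandK cV) -E' sub_capmx strand_sub /=.
apply/sub_kermxP; rewrite -E (_ : phi _ = 0) ?(strand_coord0 psiP) //.
by apply/ex; eexists.
Qed.

End Strands.

(** * Squarefree degrees and the strands of the face ring *)

Section FaceRingStrand.
Variables (k : fieldType) (m : nat) (K : scomplex m).
Local Notation S := {mpoly k[m]}.
Implicit Types (a b t : {set 'I_m}) (p : S).

Lemma indicator_le a b : (indicator a <= indicator b)%MM = (a \subset b).
Proof.
apply/mnm_lepP/subsetP => [h i ia|h i].
  by have := h i; rewrite !mnmE ia; case: (i \in b).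
by rewrite !mnmE; case ia: (i \in a) => //; rewrite h.
Qed.

Lemma le_indicator (u : 'X_{1..m}) (b : {set 'I_m}) :
  (u <= indicator b)%MM -> u = indicator [set i | u i != 0%N].
Proof.
move=> /mnm_lepP ub; apply/mnmP => i; rewrite mnmE inE.
by move: (ub i); rewrite mnmE; case: (u i) => [//|[|c]] //; case: (_ \in _).
Qed.

Lemma indicator_inj : injective (@indicator m).
Proof.
by move=> a b e; apply/eqP; rewrite eqEsubset -!indicator_le e lepm_refl.
Qed.

Lemma vmonE a : vmon k a = 'X_[indicator a].
Proof.
rewrite /vmon -(big_morph _ (@mpolyXD m k) (@mpolyX0 m k)); congr 'X_[_]; apply/mnmP => i.
rewrite mnm_sumE mnmE; case ia: (i \in a).
  rewrite (bigD1 i) //= mnm1E eqxx big1 ?addn0 // => j /andP[_ ji].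
  by rewrite mnm1E (negbTE ji).
by rewrite big1 // => j ja; rewrite mnm1E; case: eqP => // e; rewrite -e ja in ia.
Qed.

(** Subsets of a face are faces, so no generating monomial of the ideal divides the monomial of a
    face. *)
Lemma SR_ideal_coeff b p : b \in faces K -> p \in SR_ideal K -> p@_(indicator b) = 0.
Proof.
move=> bK /SR_idealP[c ->]; rewrite raddf_sum big1 // => t tK /=.
rewrite vmonE mcoeffMX_nle // indicator_le; apply: contra tK.
exact: (proj2 (facesP K)).
Qed.

Lemma face_proj_eq0 p : (face_proj K p = 0) <-> p \in SR_ideal K.
Proof.
have -> : (0 : face_ring k K) = face_proj K 0 by rewrite /face_proj rmorph0.
rewrite /face_proj -[p in p \in _]subr0.
have -> : (p - 0 \in SR_ideal K) = (p - 0 \in (SR_ideal K : idealr S)) by [].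
rewrite Quotient.idealrBE.
by split=> /eqP.
Qed.

(** For a face the coefficient does not depend on the representative; for a non-face it would, but
    there the graded piece is zero. *)
Definition face_coeff b (y : face_ring k K) : k :=
  if b \in faces K then (generic_quotient.repr y)@_(indicator b) else 0.

Lemma face_coeff_proj b p : b \in faces K ->
  face_coeff b (face_proj K p) = p@_(indicator b).
Proof.
move=> bK; rewrite /face_coeff bK; apply/eqP; rewrite -subr_eq0 -mcoeffB.
apply/eqP/(SR_ideal_coeff bK)/face_proj_eq0.
by rewrite /face_proj rmorphB /= reprK subrr.
Qed.

Lemma face_projK (y : face_ring k K) : exists p, y = face_proj K p.
Proof. by exists (generic_quotient.repr y); rewrite /face_proj reprK. Qed.

Lemma face_projZ p p' : p *: face_proj K p' = face_proj K (p * p').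
Proof. by rewrite face_projM. Qed.

Lemma strand_coord_face b :
  strand_coord (indicator b) (@face_deg k m K)
    (fun y => const_mx (face_coeff b y) : 'rV_1).
Proof.
have [bK|bK] := boolP (b \in faces K); last first.
  have c0 y : face_coeff b y = 0 by rewrite /face_coeff (negbTE bK).
  split.
  - by move=> x y; apply/rowP => j; rewrite !mxE !c0 addr0.
  - by move=> p a y _; apply/rowP => j; rewrite !mxE !c0 mulr0.
  - move=> _ [p /poly_degE -> ->] _; apply/face_proj_eq0/SR_idealP.
    (* For a non-face b, the monomial of b is itself a generator of the ideal. *)
    exists (fun t => if t == b then (p@_(indicator b))%:MP else 0).
    rewrite (bigD1 b) //= eqxx big1 ?addr0 => [|t /andP[_ /negbTE ->]].
      by rewrite vmonE mul_mpolyC.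
    by rewrite mul0r.
split.
- move=> x y; have [p ->] := face_projK x; have [p' ->] := face_projK y.
  by apply/rowP => j; rewrite !mxE -face_projD !face_coeff_proj // mcoeffD.
- move=> p a _ [p' hp' ->]; apply/rowP => j; rewrite !mxE !face_projZ.
  by rewrite !face_coeff_proj //; apply: mcoeffM_deg.
- move=> _ [p /poly_degE hp ->] /rowP/(_ 0); rewrite !mxE face_coeff_proj // => p0.
  by rewrite hp p0 scale0r /face_proj rmorph0.
Qed.

Lemma rank_strand_aug b n (d : 'I_n -> 'X_{1..m})
    (phi : {linear 'rV[S]_n -> face_ring k K}) :
    (forall u x, free_deg d u x -> face_deg u (phi x)) ->
    (forall y, exists x, phi x = y) ->
  \rank (strand_space k (indicator b) d *m
    strand_mx (indicator b) (fun y => const_mx (face_coeff b y) : 'rV_1) d phi)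
  = (b \in faces K).
Proof.
move=> hphi surj; set A := _ *m _.
have E := strand_mxE (strand_coord_face b) hphi.
have [bK|bK] := boolP (b \in faces K); last first.
  rewrite (_ : A = 0) ?mxrank0 //.
  rewrite /A (_ : strand_mx _ _ _ _ = 0) ?mulmx0 //.
  by apply/matrixP => i j; rewrite !mxE /face_coeff (negbTE bK).
apply/eqP; rewrite eqn_leq rank_leq_col lt0n mxrank_eq0.
(* The class of the monomial of b has coefficient 1 and is hit by [phi], so the strand of [phi] is
   nonzero. *)
have [x hx] := surj (face_proj K 'X_[indicator b]).
apply/eqP => A0; have /submxP[D hD] := strand_sub (indicator b) d x.
have := E x; rewrite hD -mulmxA -/A A0 mulmx0 hx => /rowP/(_ 0).
rewrite !mxE face_coeff_proj // mcoeffX eqxx => /eqP.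
by rewrite oner_eq0.
Qed.

End FaceRingStrand.

(** * Euler characteristic of a strand modulo 2, in terms of Betti numbers *)

Lemma F2_addrr (x : 'F_2) : x + x = 0.
Proof. by apply/eqP; case: x => [[|[|]]]. Qed.

Section BettiNumbers.
Variables (k : fieldType) (m : nat) (K : scomplex m).
Variable F : graded_free_resolution (@face_deg k m K).

Lemma strand_idx_parity n (b : {set 'I_m}) :
  (forall i, (n <= i)%N -> res_rank F i = 0%N) ->
  (\sum_(0 <= i < n) #|strand_idx (indicator b) (@res_shift _ _ _ _ F i)|)%:R
    = (b \in faces K)%:R :> 'F_2.
Proof.
move=> hn.
pose J i := strand_idx (indicator b) (@res_shift _ _ _ _ F i).
(* [r i] is the rank of the map leaving the strand of F_i; for [i = 0] this is the augmentation,
   whose rank is already known. *)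
pose r i := if i is i'.+1 then
    \rank (strand_space k (indicator b) (@res_shift _ _ _ _ F i'.+1) *m
      strand_mx (indicator b) (strand (indicator b) (@res_shift _ _ _ _ F i'))
        (@res_shift _ _ _ _ F i'.+1) (res_diff F i'))
  else (b \in faces K) : nat.
have Jr i : #|J i| = (r i + r i.+1)%N.
  case: i => [|i].
    rewrite /r -(rank_strand_aug b (res_aug_deg (g := F)) (res_aug_surj F)).
    apply: strand_exact (strand_coord_face k K b) _ _ _.
    - exact: res_aug_deg.
    - exact: res_diff_deg.
    - exact: res_exact0.
  exact (strand_exact (strand_coord_free k (indicator b) (@res_shift _ _ _ _ F i))
    (@res_diff_deg _ _ _ _ F i) (@res_diff_deg _ _ _ _ F i.+1)
    (@res_exact _ _ _ _ F i)).
(* Every intermediate rank occurs twice and cancels modulo 2, which replaces the alternating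
   signs. *)
have telescope p : (\sum_(0 <= i < p) #|J i|)%:R = (r 0%N + r p)%:R :> 'F_2.
  elim: p => [|p IH]; first by rewrite big_geq // natrD F2_addrr.
  rewrite big_nat_recr //= natrD IH Jr -natrD -addnA [(r p + _)%N]addnA.
  by rewrite addnCA !natrD addrA F2_addrr add0r.
rewrite telescope natrD [r n](_ : _ = 0%N) ?addr0 //.
(* F_n is zero, so the rank [r n] of the map leaving it vanishes. *)
have : #|J n| = 0%N.
  by apply/eqP; rewrite -leqn0 (leq_trans (max_card _)) // card_ord hn.
by rewrite Jr => /eqP; rewrite addn_eq0 => /andP[/eqP].
Qed.

(** A shift below a squarefree degree is squarefree, hence determined by its support; the generators
    are grouped by that support. *)
Lemma card_strand_idx i (b : {set 'I_m}) :
  #|strand_idx (indicator b) (@res_shift _ _ _ _ F i)|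
    = \sum_(a : {set 'I_m} | a \subset b) betti F i (indicator a).
Proof.
pose g (j : 'I_(res_rank F i)) : {set 'I_m} := [set l | res_shift j l != 0%N].
rewrite -sum1_card (partition_big g (fun a => a \subset b)) => [|j].
  apply: eq_bigr => a ab; rewrite sum1_card; apply: eq_card => j.
  rewrite unfold_in !inE; apply/andP/eqP => [[/le_indicator jE /eqP <-] //|e].
  by rewrite e indicator_le; split=> //; apply/eqP/indicator_inj;
     rewrite /g -e; symmetry; apply: (@le_indicator _ _ a); rewrite e lepm_refl.
by rewrite inE => jb; rewrite -indicator_le -(le_indicator jb).
Qed.

End BettiNumbers.

(** * Möbius inversion modulo 2 on the subset lattice *)

Lemma card_interval (T : finType) (c a : {set T}) : c \subset a ->
  #|[set b : {set T} | (c \subset b) && (b \subset a)]| = (2 ^ #|a :\: c|)%N.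
Proof.
move=> ca; rewrite -card_powerset.
(* Adding [c] maps the subsets of [a :\: c] bijectively onto the interval, with inverse removing
   [c]. *)
rewrite -(card_in_imset (f := fun b => b :|: c) (D := powerset (a :\: c))).
  apply: eq_card => b; rewrite inE; apply/andP/imsetP => [[cb ba]|[b']].
    exists (b :\: c); first by rewrite powersetE setSD.
    apply/setP => x; rewrite !inE; case xc: (x \in c) => /=; last by rewrite orbF.
    by rewrite (subsetP cb).
  rewrite powersetE subsetD => /andP[b'a _] ->.
  by rewrite subsetUr subUset b'a ca.
move=> b b'; rewrite !powersetE !subsetD => /andP[_ bc] /andP[_ b'c] e.
have K (d : {set T}) : [disjoint d & c] -> d = (d :|: c) :\: c.
  by move=> /setDidPl dc; rewrite setDUl setDv setU0 dc.
by rewrite (K _ bc) e -K.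
Qed.

(** After exchanging the sums, [B c] is counted once for each set between [c] and [a]: a power of 2,
    even unless [c = a]. *)
Lemma Mobius_sum m (f : {ffun {set 'I_m} -> 'F_2}) (B : {set 'I_m} -> nat) a :
    (forall b, f b = (\sum_(c : {set 'I_m} | c \subset b) B c)%:R) ->
  Mobius f a = (B a)%:R.
Proof.
move=> fE; rewrite ffunE.
under eq_bigr do rewrite fE natr_sum.
rewrite (exchange_big_dep (fun c : {set _} => c \subset a)) /=; last first.
  by move=> b c ba cb; apply: subset_trans ba.
rewrite (bigD1 a) //= [X in _ + X]big1 ?addr0 => [|c /andP[ca c_neq]].
  rewrite (bigD1 a) ?subxx //= big1 ?addr0 // => b /andP[/andP[ba ab]].
  by rewrite eqEsubset ba ab.
rewrite sumr_const -cardsE.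
rewrite (_ : [set _ | _] = [set b : {set 'I_m} | (c \subset b) && (b \subset a)]);
  last by apply/setP => b; rewrite !inE andbC.
rewrite card_interval //.
have : (0 < #|a :\: c|)%N.
  rewrite card_gt0 setD_eq0; apply: contra c_neq => ac.
  by rewrite eqEsubset ca ac.
case: #|_| => // p _; rewrite expnS mul2n -addnn mulrnDr.
exact: F2_addrr.
Qed.

Theorem corollary3p2 (k : fieldType) (m : nat) (hm : (0 < m)%N)
    (f : {ffun {set 'I_m} -> 'F_2}) (hf : nice f)
    (hvert : on_vertex_set (supp f))
    (F : graded_free_resolution
           (@face_deg k m (nice_complex hf)))
    (hmin : minimal F)
    (h : nat) (hlen : has_length F h) :
  (#|supp (Mobius f)| <=
    \sum_(0 <= i < h.+1) \sum_(a : {set 'I_m}) betti F i (indicator a))%N.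
Proof.
rewrite exchange_big /=.
pose B (a : {set 'I_m}) := (\sum_(0 <= i < h.+1) betti F i (indicator a))%N.
have fE b : f b = (\sum_(c : {set 'I_m} | c \subset b) B c)%:R.
  rewrite exchange_big /=; under eq_bigr do rewrite -card_strand_idx.
  (* The cut-off is [h.+1], since the modules vanish strictly beyond [h]. *)
  rewrite strand_idx_parity; last by case: hlen.
  by rewrite inE; apply/eqP; case: (f b) => [[|[|]]].
(* Termwise comparison: [a] contributes 1 on the left only if [B a] is odd, hence at least 1. *)
rewrite -sum1_card big_mkcond; apply: leq_sum => a _.
rewrite inE (Mobius_sum _ fE) -/(B a); case: (B a) => [|n]; last by case: ifP.
by [].
Qed.
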